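(* Let $a$ be a point of $\mathcal A^{\diamondsuit}$, with cameral cover $\pi:\tilde X^c_a\to X^c$, which satisfies condition R. Then for each $d\in D$ there exists an open disc $B_d$ with $d\in B_d\subset X^c$ such that any Stokes curve $\ell$ produced by the WKB construction applied to $a$ which enters $\pi^{-1}(B_d)$, or which is produced as a new Stokes curve starting inside $\pi^{-1}(B_d)$, does not leave $\pi^{-1}(B_d)$.
   Context: $G$ is a reductive algebraic group over $\mathbb C$ with maximal torus $T$, $\mathfrak t=\mathrm{Lie}(T)$, Weyl group $W$, roots $\Phi\subset\mathfrak t^\vee$. $X^c$ is a smooth connected compact Riemann surface, $D$ a reduced divisor with $\deg D>2$, $X=X^c\setminus D$. Put $\mathfrak t_K=K_{X^c}(D)\times_{\mathbb G_m}\mathfrak t$; the Hitchin base is $\mathcal A=\Gamma(X^c,\mathfrak t_K/\!/W)$. For $a\in\mathcal A$ the cameral cover is $\pi:\tilde X^c_a=X^c\times_{\mathfrak t_K/\!/W}\mathfrak t_K\to X^c$, with tautological $W$-equivariant map $\tilde a:\tilde X^c_a\to\mathfrak t_K$; $\tilde X=\tilde X^c_a|_X$. $\mathcal A^\diamondsuit\subset\mathcal A$ is the set of $a$ meeting the image of the root hyperplanes $(K_{X^c}(D)\times_{\mathbb G_m}\bigcup_\alpha H_\alpha)/\!/W$ transversely (in its nonsingular part); equivalently $\tilde X^c_a$ is smooth. Then all ramification points have order 2. $R\subset\tilde X$ is the ramification locus and $P\subset X$ the branch locus. Condition R. In a local coordinate $z$ vanishing at $d\in D$ write $a=r_d(z)\frac{dz}{z}$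 with $r_d$ valued in $\mathfrak t/\!/W$; a residue $\tilde r_d\in\mathfrak t$ is any lift of $r_d(0)$. $a\in\mathcal A^{\diamondsuit}$ satisfies condition R if $\tilde r_d\in\mathfrak t\setminus\bigcup_{\alpha\in\Phi}\alpha^{-1}(i\mathbb R)$ for every $d\in D$. WKB construction. For $\alpha\in\Phi$, $\chi_\alpha$ is the meromorphic 1-form on $\tilde X^c_a$ obtained by applying $\alpha$ to $\tilde a$ (a section of $\pi^*K_{X^c}(D)\otimes\mathfrak t$) and mapping $\pi^*K_{X^c}(D)\to K_{\tilde X^c}(\pi^*D)$. $V_\alpha$ is the oriented real projective vector field on $\tilde X\setminus R$ with $\chi_\alpha(V_\alpha)\in\mathbb R_+$. Curves live on $\tilde X^\circ$, the oriented real blowup of $\tilde X$ along $R$. (1) Initialization: for each $r\in R$ let $\pm\alpha$ be the two roots with $\tilde a(r)$ on their root hyperplane; the primary Stokes curves at $r$ are the integral curves of $V_\alpha$ and of $V_{-\alpha}$ starting at $r$ (three for each), labelled by $\alpha$, resp. $-\alpha$. (2) Iteration: whenever Stokes curves constructed so far, with incoming labels $\{\alpha_1,\dots,\alpha_n\}$, intersect at a point (a joint), the existing curves continue through the joint, and for each root $\gamma=\sum n_i\alpha_i$, $n_i\in\mathbb Z_{\ge0}$, $\gamma\notin\{\alpha_1,\dots,\alpha_n\}$, one adds a new Stokes curve labelled $\gamma$, the integral curve of $V_\gamma$ starting at the joint. (3) The construction terminates with an error if: a Stokes curve runs into a ramification point; the directed graph formed by the joints and boundary circles (vertices) and Stokes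 curve segments (edges) contains an oriented cycle; the labels of the curves coming into some joint do not lie in the positive roots of some polarization of $\Phi$, or the tangent rays of the curves entering and leaving a joint are not distinct; or some Stokes curve has an infinite set of limit points. The result consists of the curves produced in all iterations, when no error occurs. *)

(* Defs.v *)
From HB Require Import structures.
From mathcomp Require Import all_boot all_order all_algebra.
From mathcomp Require Import finmap complex.
From mathcomp Require Import all_classical all_reals all_analysis.

Set Implicit Arguments.
Unset Strict Implicit.
Unset Printing Implicit Defensive.

Import Order.TTheory GRing.Theory Num.Theory.
Import numFieldNormedType.Exports.

Local Open Scope classical_set_scope.
Local Open Scope ring_scope.

(* R[i] packed as a numClosedFieldType, so that it inherits the canonical
   topology, norm and derivatives of an abstract numFieldType. *)
Definition CC (R : realType) : numClosedFieldType := R[i].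

Section ReductiveGroups.
Variable R : realType.
Local Notation C := (CC R).

(* The coordinate ring C[V] of a finite-dimensional vector space V. *)
Inductive polyfun (V : lmodType C) : (V -> C) -> Prop :=
| PolyConst (k : C) : polyfun (fun _ => k)
| PolyLin (l : {linear V -> C^o}) : polyfun (fun v => l v)
| PolyAdd f g : polyfun f -> polyfun g -> polyfun (fun v => f v + g v)
| PolyMul f g : polyfun f -> polyfun g -> polyfun (fun v => f v * g v).

Variable N : nat.
Implicit Types G H T U Z : set 'M[C]_N.

(* Linear algebraic groups are realised as Zariski-closed subgroups of GL_N(C).
   Equations polynomial in the entries suffice, since powers of \det can be
   cleared from denominators. *)
Definition zariski_closed Z := exists2 E : set ('M[C]_N -> C),
  (forall f, E f -> polyfun f) &
  Z = [set g | g \in unitmx /\ forall f, E f -> f g = 0].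

Definition zariski_connected Z := forall A B,
  zariski_closed A -> zariski_closed B ->
  Z = A `|` B -> A `&` B = set0 -> A = set0 \/ B = set0.

Definition alg_group G :=
  [/\ zariski_closed G, G 1%:M,
      forall g h, G g -> G h -> G (g *m h) &
      forall g, G g -> G (invmx g)].

Definition unipotent U := forall u, U u -> exists k, (u - 1%:M) ^+ k = 0.

Definition normal_in G U :=
  U `<=` G /\ forall g u, G g -> U u -> U (g *m u *m invmx g).

(* Connected, with trivial unipotent radical. *)
Definition reductive G :=
  [/\ alg_group G, zariski_connected G &
      forall U, alg_group U -> zariski_connected U -> normal_in G U ->
        unipotent U -> U = [set 1%:M]].

Definition torus T :=
  [/\ alg_group T, zariski_connected T &
      exists2 P : 'M[C]_N, P \in unitmx &
        forall t, T t -> is_diag_mx (P *m t *m invmx P)].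

Definition maximal_torus G T :=
  [/\ torus T, T `<=` G &
      forall T', torus T' -> T' `<=` G -> T `<=` T' -> T' = T].

(* The Zariski tangent space at the identity. *)
Definition Lie H : set 'M[C]_N :=
  [set Y | forall f, polyfun f -> (forall h, H h -> f h = 0) ->
     derive1 (fun s : C => f (1%:M + s *: Y)) 0 = 0].

(* Throughout, the Lie algebra t of the maximal torus is given linear
   coordinates iota : C^n -> Lie(T); elements of t are row vectors, linear
   forms on t are column vectors, and linear maps t -> t are matrices acting
   on the right. *)
Variable n : nat.

Definition pairing (xi : 'rV[C]_n) (al : 'cV[C]_n) : C := (xi *m al) 0 0.

Definition coordinates_on_Lie (iota : {linear 'rV[C]_n -> 'M[C]_N}) T :=
  injective iota /\ range iota = Lie T.

(* Roots in the dual of t: the non-zero weights of ad(t) on Lie(G). *)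
Definition roots_of G (iota : {linear 'rV[C]_n -> 'M[C]_N}) : set 'cV[C]_n :=
  [set al | al != 0 /\ exists Y, [/\ Lie G Y, Y != 0 &
     forall h, iota h *m Y - Y *m iota h = pairing h al *: Y]].

(* N_G(T) / Z_G(T), identified with its image in GL(t). *)
Definition weyl G T (iota : {linear 'rV[C]_n -> 'M[C]_N}) : set 'M[C]_n :=
  [set w | exists2 g, G g & [set g *m t *m invmx g | t in T] = T /\
     forall h, iota (h *m w) = g *m iota h *m invmx g].

End ReductiveGroups.

Section RiemannSurfaces.
Variable R : realType.
Local Notation C := (CC R).

Definition holomorphic_on (A : set C) (f : C -> C) :=
  forall z, A z -> derivable f z 1.

Section Charts.
Variable X : topologicalType.

(* coord is relevant on dom only, icoord on coord @` dom only. *)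
Record chart := Chart { dom : set X; coord : X -> C; icoord : C -> X }.

Definition is_chart (c : chart) :=
  [/\ open (dom c), open (coord c @` dom c),
      forall x, dom c x -> icoord c (coord c x) = x,
      forall x, dom c x -> {for x, continuous (coord c)} &
      forall z, (coord c @` dom c) z -> {for z, continuous (icoord c)}].

Definition compatible (c c' : chart) :=
  holomorphic_on (coord c @` (dom c `&` dom c')) (coord c' \o icoord c) /\
  holomorphic_on (coord c' @` (dom c `&` dom c')) (coord c \o icoord c').

End Charts.

Record riemann_surface := RiemannSurface {
  space :> topologicalType;
  atlas : set (chart space);
  space_hausdorff : hausdorff_space space;
  atlas_cover : forall x, exists2 c, atlas c & dom c x;
  atlas_chart : forall c, atlas c -> is_chart c;
  atlas_compatible : forall c c', atlas c -> atlas c' -> compatible c c' }.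

Definition local_coordinate (X : riemann_surface) (c : chart X) :=
  is_chart c /\ forall c', atlas c' -> compatible c c'.

Definition open_disc (X : riemann_surface) (B : set X) :=
  exists c : chart X, local_coordinate c /\
  exists z0 rho : C, [/\ 0 < rho, ball z0 rho `<=` coord c @` dom c &
    B = dom c `&` coord c @^-1` ball z0 rho].

End RiemannSurfaces.

Section Cameral.
Variables (R : realType) (X : riemann_surface R) (D : {fset X}) (n : nat).
Local Notation C := (CC R).
Variables (Phi : set 'cV[C]_n) (W : set 'M[C]_n).

(* Coordinates z in which K(D) is trivialised by dz/z (if a point of D lies in
   the domain, which is then unique and is the zero of z) or by dz (if not). *)
Definition log_chart (c : chart R X) :=
  local_coordinate c /\
  forall d, d \in D -> dom c d -> coord c d = 0.

Definition log_chart_at (c : chart R X) (x : X) := log_chart c /\ dom c x.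

(* The trivialising section of K(D) is frame c * dz, away from D. *)
Definition frame (c : chart R X) (x : X) : C :=
  if `[< exists2 d, d \in D & dom c d >] then (coord c x)^-1 else 1.

(* (trivialising section of c) = transition c c' * (trivialising section of
   c'). On D both coefficients are the residue, which is independent of the
   coordinate. *)
Definition transition (c c' : chart R X) (x : X) : C :=
  if x \in D then 1
  else frame c x / frame c' x * derive1 (coord c \o icoord c') (coord c' x).

(* A point of the total space of t_K = K(D) (x) t is a point x of X^c together
   with its fibre coordinates in t with respect to all log charts at x. *)
Definition tK_point : Type := (X * (chart R X -> 'rV[C]_n))%type.

Definition in_tK (p : tK_point) :=
  (forall c c', log_chart_at c p.1 -> log_chart_at c' p.1 ->
     p.2 c' = transition c c' p.1 *: p.2 c) /\
  (forall c, ~ log_chart_at c p.1 -> p.2 c = 0).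

Definition nbhs_tK (p : tK_point) : set (set tK_point) :=
  [set V | exists c, log_chart_at c p.1 /\
     exists U A, [/\ nbhs p.1 U, nbhs (p.2 c) A &
       forall q, U q.1 -> dom c q.1 -> A (q.2 c) -> V q]].

(* Points of t//W are the W-orbits in t, and its functions are C[t]^W. A
   section of t_K//W is given, in each log chart, by an orbit-valued function
   along which invariant polynomials pull back to holomorphic functions. *)
Definition W_orbit (A : set 'rV[C]_n) :=
  exists xi, A = [set xi *m w | w in W].

Definition invariant_poly (f : 'rV[C]_n -> C) :=
  polyfun f /\ forall w xi, W w -> f (xi *m w) = f xi.

Definition local_sections := chart R X -> X -> set 'rV[C]_n.

(* F is the function f o a, written in the coordinate of c. *)
Definition is_pullback (a : local_sections) c (f : 'rV[C]_n -> C)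
    (F : C -> C) :=
  holomorphic_on (coord c @` dom c) F /\
  forall x xi, dom c x -> a c x xi -> F (coord c x) = f xi.

Definition hitchin_base (a : local_sections) := forall c, log_chart c ->
  [/\ forall x, dom c x -> W_orbit (a c x),
      forall f, invariant_poly f -> exists F, is_pullback a c f F &
      forall c' x, log_chart c' -> dom c x -> dom c' x ->
        a c' x = [set transition c c' x *: xi | xi in a c x]].

Definition vanishes_on_hyperplanes (f : 'rV[C]_n -> C) :=
  forall al xi, Phi al -> pairing xi al = 0 -> f xi = 0.

(* Let H be the image of the root hyperplanes in t//W. Wherever a meets H, its
   derivative is not contained in the Zariski tangent space of H, that is, it
   is not killed by the differentials of all functions vanishing on H. At a
   nonsingular point of the hypersurface H this is transversality; at a
   singular point the Zariski tangent space is everything, so that a avoids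
   the singular points. *)
Definition hitchin_base_diamond (a : local_sections) :=
  hitchin_base a /\
  forall c x, log_chart_at c x ->
    (exists xi al, [/\ a c x xi, Phi al & pairing xi al = 0]) ->
    exists f F, [/\ invariant_poly f, vanishes_on_hyperplanes f,
      is_pullback a c f F & derive1 F (coord c x) != 0].

Definition condition_R (a : local_sections) :=
  forall d c xi al, d \in D -> log_chart_at c d -> a c d xi -> Phi al ->
    complex.Re (pairing xi al) != 0.

Variable a : local_sections.

(* The projection to X^c is fst, and the tautological map to t_K is the
   inclusion. *)
Definition cameral_cover : set tK_point :=
  [set p | in_tK p /\ forall c, log_chart_at c p.1 -> a c p.1 (p.2 c)].

Definition cameral_cover_X : set tK_point :=
  [set p | cameral_cover p /\ p.1 \notin D].

(* Points of ramification of a branched cover of smooth curves: those near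
   which it is not injective. *)
Definition ramified : set tK_point :=
  [set p | cameral_cover_X p /\ forall V, nbhs_tK p V ->
     exists q q', [/\ V q /\ cameral_cover q, V q' /\ cameral_cover q',
       q <> q' & q.1 = q'.1]].

(* The value of chi_al on the tangent vector at p with dz-component v, for z
   the coordinate of c. Outside the ramification locus z is also a local
   coordinate on the cameral cover. *)
Definition chi (c : chart R X) (al : 'cV[C]_n) (p : tK_point) (v : C) : C :=
  pairing (p.2 c) al * frame c p.1 * v.

(* A labelled curve defined on the half-open interval [0, duration[ . *)
Record curve := Curve {
  label : 'cV[C]_n; duration : \bar R; traj : R -> tK_point }.

Definition life (l : curve) (s : R) := 0 <= s /\ (s%:E < duration l)%E.

(* V_al is only defined up to positive factors; its integral curves are
   parametrised by the representative with chi_al(V_al) = 1. Values of traj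
   outside [0, duration[ are set to the starting point, so that equality of
   curves is equality of records. The starting point may be ramified. *)
Definition integral_curve (l : curve) :=
  [/\ (0 < duration l)%E,
      forall s, life l s -> nbhs_tK (traj l s) `<=` traj l @ s,
      forall s, ~ life l s -> traj l s = traj l 0 &
      forall s, life l s -> 0 < s ->
        [/\ cameral_cover_X (traj l s), ~ ramified (traj l s) &
          forall c, log_chart_at c (traj l s).1 -> exists u v : R,
            [/\ is_derive s 1 (fun t => complex.Re (coord c (traj l t).1)) u,
                is_derive s 1 (fun t => complex.Im (coord c (traj l t).1)) v &
                chi c (label l) (traj l s) (u +i* v)%C = 1]]].

Definition maximal_curve (l : curve) :=
  integral_curve l /\
  forall l', integral_curve l' -> label l' = label l ->
    (forall s, life l s -> traj l' s = traj l s) ->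
    (duration l' <= duration l)%E.

Definition on_hyperplane (al : 'cV[C]_n) (p : tK_point) :=
  forall c, log_chart_at c p.1 -> pairing (p.2 c) al = 0.

(* Passing to the real blowup only separates the starting points of the primary
   curves at r, which is achieved here by never treating a ramification point
   as an intersection point. *)
Definition primary_curves : set curve :=
  [set l | maximal_curve l /\ Phi (label l) /\
     ramified (traj l 0) /\ on_hyperplane (label l) (traj l 0)].

Section Iteration.
Variable S : set curve.

Definition incoming (p : tK_point) (al : 'cV[C]_n) :=
  exists l s, [/\ S l, label l = al, life l s, 0 < s & traj l s = p].

Definition outgoing (p : tK_point) (al : 'cV[C]_n) :=
  exists l s, [/\ S l, label l = al, life l s & traj l s = p].

(* Two curves through p with the same label coincide after p, so that the
   curves which intersect at p are distinguished by their labels. *)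
Definition joint (p : tK_point) :=
  [/\ cameral_cover_X p, ~ ramified p &
      exists al be, [/\ outgoing p al, outgoing p be & al <> be]].

Definition new_curves : set curve :=
  [set l | maximal_curve l /\ joint (traj l 0) /\ Phi (label l) /\
     ~ incoming (traj l 0) (label l) /\
     exists2 als : seq 'cV[C]_n,
       (forall al, al \in als -> incoming (traj l 0) al) &
       label l = \sum_(al <- als) al].

Definition runs_into (l : curve) (p : tK_point) := forall V, nbhs_tK p V ->
  exists2 s0, life l s0 & forall s, life l s -> s0 < s -> V (traj l s).

Definition limit_points (l : curve) : set tK_point :=
  [set p | cameral_cover p /\ forall V, nbhs_tK p V -> forall s0, life l s0 ->
     exists s, [/\ life l s, s0 < s & V (traj l s)]].

(* A ramification point stands for its boundary circle in the blowup. *)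
Definition vertex (p : tK_point) := joint p \/ ramified p.

Definition edge (p q : tK_point) := vertex p /\ vertex q /\
  exists l s s', S l /\ [/\ life l s, life l s', s < s', traj l s = p &
    traj l s' = q] /\ forall u, s < u < s' -> ~ vertex (traj l u).

Definition has_oriented_cycle := exists (m : nat) (v : nat -> tK_point),
  v 0%N = v m.+1 /\ forall i, (i <= m)%N -> edge (v i) (v i.+1).

(* The positive roots of a polarization of Phi. *)
Definition positive_system (P : set 'cV[C]_n) :=
  [/\ P `<=` Phi,
      forall al, Phi al -> P al \/ P (- al),
      forall al, P al -> ~ P (- al) &
      forall al be, P al -> P be -> Phi (al + be) -> P (al + be)].

(* The tangent ray, in the coordinate of c, of a curve labelled al leaving p
   (b = false), or entering p and hence on the opposite side (b = true). For
   complex numbers, 0 < z means that z is real and positive. *)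
Definition tangent_ray (c : chart R X) (p : tK_point) (b : bool)
    (al : 'cV[C]_n) : set C := [set v | 0 < chi c al p ((-1) ^+ b * v)].

Definition at_joint (p : tK_point) (b : bool) (al : 'cV[C]_n) :=
  if b then incoming p al else outgoing p al.

Definition distinct_rays (p : tK_point) := forall b b' al al',
  at_joint p b al -> at_joint p b' al' -> (b, al) <> (b', al') ->
  forall c, log_chart_at c p.1 ->
    tangent_ray c p b al <> tangent_ray c p b' al'.

Definition error :=
  [\/ exists l r, [/\ S l, ramified r & runs_into l r],
      has_oriented_cycle,
      exists p, joint p /\
        ((forall P, positive_system P -> ~ (incoming p `<=` P)) \/
         ~ distinct_rays p) |
      exists2 l, S l & ~ finite_set (limit_points l)].

End Iteration.

Definition stage (k : nat) : set curve :=
  iter k (fun S => S `|` new_curves S) primary_curves.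

Definition no_error := forall k, ~ error (stage k).

(* The output of the WKB construction; it is only defined without errors. *)
Definition stokes_curve (l : curve) := no_error /\ exists k, stage k l.

Definition new_stokes_curve (l : curve) :=
  no_error /\ exists k, new_curves (stage k) l.

Definition lies_over (B : set X) : set tK_point := fst @^-1` B.

Definition enters_at (l : curve) (B : set X) (s : R) :=
  [/\ life l s, lies_over B (traj l s) &
      exists s0, [/\ life l s0, s0 < s & ~ lies_over B (traj l s0)]].

Definition stays_from (l : curve) (B : set X) (s : R) :=
  forall u, life l u -> s <= u -> lies_over B (traj l u).

End Cameral.

(* Main.v *)
Require Import Defs.
From HB Require Import structures.
From mathcomp Require Import all_boot all_order all_algebra.
From mathcomp Require Import finmap complex.
From mathcomp Require Import all_classical all_reals all_analysis.
From mathcomp Require Import ring lra.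

(** Let z be a logarithmic coordinate vanishing at d. A curve labelled al is an
    integral curve of dz/dt = z / <xi, al>, where xi is the point of t lying
    over it, so that |z|^2 has derivative 2 |dz/dt|^2 Re <xi, al>
    ([derive_normsq]). At d the numbers Re <xi, al> are non-zero by condition R,
    and they stay so over a whole disc B around d ([Re_roots_near]). Along a
    curve inside B the sign of Re <xi, al> is then constant, and |z| is
    monotone. A curve that comes in from outside crosses the circle inwards,
    so its sign is negative ([slope_lt0_entering]); a curve of negative sign
    has non-increasing |z| and cannot come out again ([stays_of_slope_lt0]).

    It remains to see that the curves born in B also have negative sign, which
    is an induction on the stages of the construction ([stage_slope_lt0]). No
    primary curve starts in B: its starting point lies on a root hyperplane,
    where Re <xi, al> = 0. A new curve starting in B is labelled by a sum of
    labels of curves which arrive at its starting point; these have negative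
    sign by induction, hence so has the sum ([slope_sum_lt0]).

    The sign condition spreads from d to a disc because the fibre of the
    cameral cover moves continuously. This is expressed through invariant
    polynomials: if a polynomial g vanishes on the fibre over d, the
    coefficients of the product of X - g(xi w) over w in W are W-invariant,
    hence holomorphic in z, and they vanish at d except for the leading one;
    so all the roots g(xi) tend to 0 ([polyfun_near_orbit]). The argument uses
    that W and the set of roots are finite. Both facts follow from the joint
    diagonalisation of Lie(T) ([Lie_torus_weights]): a root is a difference of
    two weights, and an element of W is determined by the way it permutes
    them. *)

Set Implicit Arguments.
Unset Strict Implicit.
Unset Printing Implicit Defensive.

Import Order.TTheory GRing.Theory Num.Theory.
Import numFieldNormedType.Exports.

Local Open Scope classical_set_scope.
Local Open Scope ring_scope.

(* The coordinate function of a chart, as opposed to coordinates in a basis. *)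
Local Notation coord := Defs.coord.

(** * Finiteness of the root system and of the Weyl group *)

Section FiniteWeylGroup.
Variables (R : realType) (N n : nat).
Local Notation C := (CC R).
Variables (G T : set 'M[C]_N) (iota : {linear 'rV[C]_n -> 'M[C]_N}).

(** Stated as a function so that it can be declared linear and thereby be used
    as a polynomial function on matrices. *)
Definition conj_entry (P : 'M[C]_N) (i j : 'I_N) (Y : 'M[C]_N) : C^o :=
  (P *m Y *m invmx P) i j.

Lemma conj_entry_is_linear P i j : linear (conj_entry P i j).
Proof.
by move=> k Y Z; rewrite /conj_entry mulmxDr mulmxDl -scalemxAr -scalemxAl !mxE.
Qed.

HB.instance Definition _ P i j := GRing.isLinear.Build C 'M[C]_N C^o _
  (conj_entry P i j) (conj_entry_is_linear P i j).

(** An off-diagonal entry, in a basis diagonalising T, is a linear function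
    vanishing on T. Being linear, it is its own derivative at the identity, so
    it vanishes on the Zariski tangent space. *)
Lemma Lie_diagonal (P : 'M[C]_N) Y : P \in unitmx ->
  (forall t, T t -> is_diag_mx (P *m t *m invmx P)) -> Lie T Y ->
  is_diag_mx (P *m Y *m invmx P).
Proof.
move=> Pu Tdiag LTY; apply/is_diag_mxP => i j ij.
have := LTY (fun g => conj_entry P i j g) (PolyLin (conj_entry P i j)).
have -> : (fun s : C => conj_entry P i j (1%:M + s *: Y)) =
          (fun s : C => s * conj_entry P i j Y).
  apply/funext => s; rewrite linearD linearZ /= [X in X + _](_ : _ = 0) ?add0r//.
  by rewrite /conj_entry mulmx1 mulmxV// mxE -val_eqE (negPf ij).
rewrite derive1E deriveM //= derive_cst derive_id scaler0 add0r.
rewrite [_ *: _]mulr1; apply=> t Tt.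
by have /is_diag_mxP/(_ i j ij) := Tdiag _ Tt.
Qed.

Hypothesis hG : alg_group G.
Hypothesis hT : torus T.
Hypothesis hiota : coordinates_on_Lie iota T.

(** The columns of M are the weights of the tautological representation of
    Lie(T), with multiplicity, in the coordinates given by iota. *)
Lemma Lie_torus_weights : exists2 P : 'M[C]_N, P \in unitmx &
  exists M : 'M[C]_(n, N), forall h,
    P *m iota h = diag_mx (h *m M) *m P.
Proof.
have [_ _ [P Pu Tdiag]] := hT; exists P => //.
exists (\matrix_(k, j) conj_entry P j j (iota (delta_mx 0 k))) => h.
suff -> : diag_mx (h *m \matrix_(k, j) conj_entry P j j (iota (delta_mx 0 k))) =
    P *m iota h *m invmx P by rewrite mulmxKV.
apply/matrixP => i j; rewrite mxE; have [<-|ij] := eqVneq i j; last first.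
  have [_ im] := hiota.
  have /is_diag_mxP/(_ i j ij)-> // : is_diag_mx (P *m iota h *m invmx P).
  by apply: Lie_diagonal => //; rewrite -im; exists h.
rewrite mulr1n mxE.
transitivity (conj_entry P i i (iota h)) => //.
rewrite [in RHS](row_sum_delta h) !linear_sum /=; apply: eq_bigr => k _.
by rewrite !linearZ /= mxE.
Qed.

(** If Y is a root vector, then in a basis of weight vectors any non-zero entry
    (i, j) of Y forces the root to be the difference of the i-th and j-th
    weights. *)
Lemma roots_finite : finite_set (roots_of G iota).
Proof.
have [P Pu [M PM]] := Lie_torus_weights.
apply: (@sub_finite_set _ _
  [set (col ij.1 M - col ij.2 M) | ij in [set: 'I_N * 'I_N]]); last first.
  exact/finite_image/finite_finset.
move=> al [al0 [Y [_ Y0 adY]]].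
have Y'0 : P *m Y *m invmx P != 0.
  apply: contra Y0 => /eqP Y'0.
  by rewrite -[Y](mulKmx Pu) -[P *m Y](mulmxKV Pu) Y'0 mul0mx mulmx0.
have [i [j Yij]] : exists i j, (P *m Y *m invmx P) i j != 0.
  apply: contrapT => nY; case/eqP: Y'0; apply/matrixP => i j; rewrite [RHS]mxE.
  by apply: contrapT => Yij; apply: nY; exists i, j; apply/eqP.
exists (i, j) => //=.
have key h : (h *m M) 0 i - (h *m M) 0 j = pairing h al.
  apply: (mulIf Yij).
  have := congr1 (fun Z => (P *m Z *m invmx P) i j) (adY h).
  rewrite /= mulmxBr mulmxBl -scalemxAr -scalemxAl !mulmxA PM.
  have -> : P *m Y *m iota h *m invmx P =
            P *m Y *m invmx P *m diag_mx (h *m M).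
    rewrite -[iota h](mulKmx Pu) PM !mulmxA.
    by rewrite -[LHS]mulmxA mulmxV// mulmx1.
  have -> : diag_mx (h *m M) *m P *m Y *m invmx P =
            diag_mx (h *m M) *m (P *m Y *m invmx P) by rewrite !mulmxA.
  move: (P *m Y *m invmx P) => Z; rewrite mul_diag_mx mul_mx_diag.
  by rewrite !mxE => <-; rewrite mulrBl [X in _ - X]mulrC.
apply/matrixP => k k0; rewrite ord1 {k0} !mxE.
have := key (delta_mx 0 k); rewrite /pairing -!rowE !mxE => ->.
by [].
Qed.

(** If g represents w, its matrix Q in a basis of weight vectors intertwines
    the weights with their images under w, so every non-zero entry (i, j) of Q
    forces w to send the i-th weight to the j-th. As the weights determine
    iota h, and hence h, they determine w. *)
Lemma weyl_finite : finite_set (weyl G T iota).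
Proof.
have [P Pu [M PM]] := Lie_torus_weights.
have [injio _] := hiota.
have [[E _ Gdef] _ _ _] := hG.
pose F (w : 'M[C]_n) := w *m M.
have Finj : injective F.
  move=> w w' ww'; apply/row_matrixP => i; rewrite !rowE; apply: injio.
  apply: (can_inj (mulKmx Pu)); rewrite !PM -!mulmxA.
  by rewrite -/(F w) -/(F w') ww'.
apply: (@sub_finite_set _ _ (F @^-1`
   [set \matrix_(k, i) M k (s i) | s in [set: {ffun 'I_N -> 'I_N}]])).
  move=> w [g Gg [_ gw]] /=.
  have gu : g \in unitmx by move: Gg; rewrite Gdef => -[].
  pose Q := P *m g *m invmx P.
  have Qu : Q \in unitmx by rewrite !unitmx_mul Pu gu unitmx_inv.
  have key (h : 'rV[C]_n) i j :
      (h *m w *m M) 0 i * Q i j = Q i j * (h *m M) 0 j.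
    have : diag_mx (h *m w *m M) *m Q = Q *m diag_mx (h *m M).
      have -> : diag_mx (h *m w *m M) *m Q =
          P *m (iota (h *m w) *m g) *m invmx P.
        by rewrite mulmxA PM /Q !mulmxA.
      rewrite gw mulmxKV// /Q -[iota h](mulKmx Pu) PM !mulmxA.
      by rewrite -[LHS]mulmxA mulmxV// mulmx1.
    by move=> /matrixP/(_ i j); rewrite mul_diag_mx mul_mx_diag !mxE.
  (* An invertible matrix has no zero row. *)
  have /choice[s sP] i : exists j, Q i j != 0.
    apply: contrapT => nQ.
    have : row i Q *m invmx Q = 0.
      rewrite (_ : row i Q = 0) ?mul0mx//; apply/rowP => j.
      rewrite [LHS]mxE [RHS]mxE.
      by apply: contrapT => Qij; apply: nQ; exists j; apply/eqP.
    rewrite -row_mul mulmxV// => /rowP/(_ i); rewrite !mxE eqxx.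
    by move/eqP; rewrite oner_eq0.
  exists [ffun i => s i] => //; apply/matrixP => k i; rewrite mxE ffunE.
  have := key (delta_mx 0 k) i (s i).
  rewrite [RHS]mulrC => /(mulIf (sP i)).
  by rewrite -mulmxA -!rowE !mxE => ->.
apply: finite_preimage; first by move=> ? ? _ _; exact: Finj.
exact/finite_image/finite_finset.
Qed.

Lemma weyl1 : weyl G T iota 1%:M.
Proof.
have [_ G1 _ _] := hG.
exists 1%:M => //; split=> [|h]; rewrite invmx1; last by rewrite !mulmx1 mul1mx.
apply/seteqP; split=> [_ [t Tt <-]|t Tt]; first by rewrite mul1mx mulmx1.
by exists t => //; rewrite mul1mx mulmx1.
Qed.

Lemma weylM w w' : weyl G T iota w -> weyl G T iota w' ->
  weyl G T iota (w *m w').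
Proof.
have [[E _ Gdef] _ GM _] := hG.
have Gu g : G g -> g \in unitmx by rewrite Gdef => -[].
move=> [g Gg [gT gw]] [g' Gg' [gT' gw']].
have invM : invmx (g' *m g) = invmx g *m invmx g'.
  have g'gu : g' *m g \in unitmx by rewrite unitmx_mul !Gu.
  have g'gV : g' *m g *m (invmx g *m invmx g') = 1%:M.
    by rewrite mulmxA mulmxK ?Gu// mulmxV ?Gu.
  by rewrite -[RHS](mulKmx g'gu) g'gV mulmx1.
exists (g' *m g); first exact: GM.
split=> [|h]; last by rewrite mulmxA gw' gw invM !mulmxA.
apply/seteqP; split=> [_ [t Tt <-]|t].
  have Tgt : T (g *m t *m invmx g) by rewrite -gT; exists t.
  by rewrite -gT'; exists (g *m t *m invmx g) => //; rewrite invM !mulmxA.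
rewrite -{1}gT' => -[t']; rewrite -{1}gT => -[t'' Tt'' <-] <-.
by exists t'' => //; rewrite invM !mulmxA.
Qed.

Lemma weyl_unit w : weyl G T iota w -> w \in unitmx.
Proof.
have [[E _ Gdef] _ _ _] := hG; have [injio _] := hiota.
move=> [g Gg [_ gw]]; have gu : g \in unitmx by move: Gg; rewrite Gdef => -[].
rewrite -row_free_unit -kermx_eq0; apply/eqP/row_matrixP => i.
rewrite row0; apply: injio; rewrite linear0.
have := gw (row i (kermx w)); rewrite -row_mul mulmx_ker row0 linear0 => /esym.
move=> /(congr1 (mulmx (invmx g) \o mulmxr g)) /=.
by rewrite mulmxKV// mulKmx// mul0mx mulmx0.
Qed.

End FiniteWeylGroup.

(** * Real and imaginary parts *)

Section ComplexPlane.
Variable R : realType.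
Local Notation C := (CC R).

Definition normsq (z : C) : R := complex.Re z ^+ 2 + complex.Im z ^+ 2.

Lemma normsq_lt (z : C) (r : R) : 0 < r ->
  (`|z| < (r%:C)%C) = (normsq z < r ^+ 2).
Proof.
move=> r0; rewrite (normc_def z) ltcR -/(normsq z) -[RHS]ltr_sqrt ?exprn_gt0//.
by rewrite sqrtr_sqr gtr0_norm.
Qed.

Lemma normC_ge_Re (z : C) : ((`|complex.Re z|)%:C)%C <= `|z|.
Proof.
rewrite (normc_def z) lecR -sqrtr_sqr ler_wsqrtr// lerDl; exact: sqr_ge0.
Qed.

Lemma normC_ge_Im (z : C) : ((`|complex.Im z|)%:C)%C <= `|z|.
Proof.
rewrite (normc_def z) lecR -sqrtr_sqr ler_wsqrtr// lerDr; exact: sqr_ge0.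
Qed.

Lemma continuous_Re : continuous (fun z : C => complex.Re z).
Proof.
move=> z; apply: (iffRL (@cvgrPdist_lt _ _ _ (nbhs z) _ _ _)) => e e0.
have eC0 : 0 < (e%:C)%C :> C by rewrite -[0]/((0 : R)%:C)%C ltcR.
apply: (@filterS _ (nbhs z) _ _ _ _ (nbhsx_ballx z _ eC0)) => w.
rewrite /ball /= => zw.
rewrite -ltcR; apply: le_lt_trans zw; have := normC_ge_Re (z - w).
by case: z => ? ?; case: w.
Qed.

Lemma continuous_Im : continuous (fun z : C => complex.Im z).
Proof.
move=> z; apply: (iffRL (@cvgrPdist_lt _ _ _ (nbhs z) _ _ _)) => e e0.
have eC0 : 0 < (e%:C)%C :> C by rewrite -[0]/((0 : R)%:C)%C ltcR.
apply: (@filterS _ (nbhs z) _ _ _ _ (nbhsx_ballx z _ eC0)) => w.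
rewrite /ball /= => zw.
rewrite -ltcR; apply: le_lt_trans zw; have := normC_ge_Im (z - w).
by case: z => ? ?; case: w.
Qed.

End ComplexPlane.

(** * Continuity of the fibres of the cameral cover *)

(** The bounds on the coefficients are chosen so that a root y with
    eta <= |y| would satisfy |y|^m < m * (|y|^m / m). *)
Lemma monic_root_lt (F : numFieldType) (p : {poly F}) (y eta : F) m :
  p \is monic -> size p = m.+1 -> root p y -> 0 < eta ->
  (forall i, (i < m)%N -> `|p`_i| < eta ^+ (m - i) / m%:R) -> `|y| < eta.
Proof.
move=> pmon sp /rootP py eta0 pi.
rewrite real_ltNge ?normr_real ?gtr0_real//; apply/negP => etay.
have y0 : 0 < `|y| by exact: lt_le_trans etay.
have m0 : (0 < m)%N.
  case: m sp pi => // sp _; move: pmon py.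
  rewrite (size1_polyC (p := p)) ?sp// monicE lead_coefC hornerC => /eqP-> /eqP.
  by rewrite oner_eq0.
have ym : y ^+ m = - \sum_(i < m) p`_i * y ^+ i.
  move: py; rewrite horner_coef sp big_ord_recr /=.
  move: pmon; rewrite monicE lead_coefE sp => /eqP->; rewrite mul1r addrC.
  by move/eqP; rewrite addr_eq0 => /eqP.
suff : `|y| ^+ m < `|y| ^+ m by rewrite ltxx.
rewrite -[ltLHS]normrX ym normrN.
apply: (le_lt_trans (ler_norm_sum _ _ _)).
have -> : `|y| ^+ m = \sum_(i < m) (`|y| ^+ (m - i) / m%:R) * `|y| ^+ i.
  rewrite (eq_bigr (fun=> `|y| ^+ m / m%:R)).
    by rewrite sumr_const card_ord -[RHS]mulr_natr divfK// pnatr_eq0 -lt0n.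
  by move=> i _; rewrite mulrAC -exprD subnK// ltnW.
apply: ltr_sum.
  by apply/hasP; exists (Ordinal m0); rewrite ?mem_index_enum.
move=> i _; rewrite normrM normrX ltr_pM2r ?exprn_gt0//.
apply: (lt_le_trans (pi i _)) => //.
by rewrite ler_pM2r ?invr_gt0 ?ltr0n// lerXn2r// nnegrE ltW.
Qed.

Section Invariants.
Variables (R : realType) (n : nat).
Local Notation C := (CC R).
Implicit Types (w : 'M[C]_n) (xi : 'rV[C]_n) (g : 'rV[C]_n -> C).

Lemma polyfun_mulmxr g w : polyfun g -> polyfun (fun xi => g (xi *m w)).
Proof.
elim=> {g} [k|l|f g _ pf _ pg|f g _ pf _ pg].
- exact: PolyConst.
- exact: (PolyLin (l \o mulmxr w)).
- exact: PolyAdd.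
- exact: PolyMul.
Qed.

(** The characteristic polynomial of the values of g on the W-orbit of xi, when
    ws enumerates W. *)
Definition orbit_poly (ws : seq 'M[C]_n) g xi : {poly C} :=
  \prod_(w <- ws) ('X - (g (xi *m w))%:P).

Lemma polyfun_orbit_poly ws g i : polyfun g ->
  polyfun (fun xi => (orbit_poly ws g xi)`_i).
Proof.
move=> pg; elim: ws i => [|w ws IH] i; rewrite /orbit_poly.
  by under eq_fun do rewrite big_nil coef1; exact: PolyConst.
under eq_fun do rewrite big_cons mulrBl coefB coefXM coefCM -mulN1r mulrA.
apply: PolyAdd; first by case: i => [|i]; [exact: PolyConst|exact: IH].
apply: PolyMul (IH i); apply: PolyMul (polyfun_mulmxr w pg).
exact: PolyConst.
Qed.

Variable W : set 'M[C]_n.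
Hypothesis W1 : W 1%:M.
Hypothesis WM : forall w w', W w -> W w' -> W (w *m w').
Hypothesis Wunit : forall w, W w -> w \in unitmx.
Variable ws : seq 'M[C]_n.
Hypothesis ws_uniq : uniq ws.
Hypothesis wsE : W = [set` ws].

(** Left multiplication by w permutes W, hence the factors. *)
Lemma orbit_poly_invariant g w xi : W w ->
  orbit_poly ws g (xi *m w) = orbit_poly ws g xi.
Proof.
move=> Ww; rewrite /orbit_poly.
under eq_bigr do rewrite -mulmxA.
rewrite -(big_map (mulmx w) xpredT (fun v => 'X - (g (xi *m v))%:P)).
have injw : injective (mulmx w : 'M[C]_n -> 'M[C]_n).
  exact/can_inj/mulKmx/Wunit.
apply: perm_big; have wsu : uniq (map (mulmx w) ws) by rewrite map_inj_uniq.
apply: uniq_perm => //; apply: (uniq_min_size wsu _ _).2; last first.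
  by rewrite size_map.
move=> _ /mapP[v vws ->]; have : W (w *m v) by apply: WM => //; rewrite wsE.
by rewrite wsE.
Qed.

Lemma invariant_orbit_poly g i : polyfun g ->
  invariant_poly W (fun xi => (orbit_poly ws g xi)`_i).
Proof.
move=> pg; split; first exact: polyfun_orbit_poly.
by move=> w xi Ww; rewrite orbit_poly_invariant.
Qed.

Lemma size_orbit_poly g xi : size (orbit_poly ws g xi) = (size ws).+1.
Proof. exact: size_prod_XsubC. Qed.

Lemma root_orbit_poly g xi : root (orbit_poly ws g xi) (g xi).
Proof.
apply/rootP; rewrite /orbit_poly horner_prod.
apply/eqP; rewrite prodf_seq_eq0; apply/hasP; exists 1%:M; last first.
  by rewrite /= mulmx1 !hornerE subrr.
by have := W1; rewrite wsE.
Qed.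

Variables (X : riemann_surface R) (D : {fset X}) (a : local_sections X n).
Hypothesis ha : hitchin_base D W a.

(** Near x0 the functions g, restricted to the fibres of the cameral cover, are
    small: their values are the roots of a monic polynomial whose coefficients
    are continuous in x, and which is a power of the variable at x0. *)
Lemma polyfun_near_orbit c x0 g (eta : C) : log_chart_at D c x0 ->
  polyfun g -> (forall xi, a c x0 xi -> g xi = 0) -> 0 < eta ->
  \forall x \near x0, dom c x -> forall xi, a c x xi -> `|g xi| < eta.
Proof.
move=> [cl x0c] pg g0 eta0; have [orb inv _] := ha cl.
have [[[_ _ _ coord_cont _] _] _] := cl.
pose m := size ws.
have [xi0 ax0] := orb x0 x0c.
have coef0 i : (i < m)%N -> forall xi, a c x0 xi -> (orbit_poly ws g xi)`_i = 0.
  move=> im xi axi.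
  suff -> : orbit_poly ws g xi = 'X^m by rewrite coefXn ltn_eqF.
  rewrite /orbit_poly big_seq (eq_bigr (fun=> 'X)) => [|w wws].
    by rewrite -big_seq big_const_seq count_predT iter_mulr_1.
  rewrite g0 ?subr0// ax0; move: axi; rewrite ax0 => -[w' Ww' <-].
  by exists (w' *m w); [apply: WM => //; rewrite wsE|rewrite mulmxA].
have near_coef (i : 'I_m) : \forall x \near x0, dom c x ->
    forall xi, a c x xi -> `|(orbit_poly ws g xi)`_i| < eta ^+ (m - i) / m%:R.
  have [F [Fhol Fa]] := inv _ (invariant_orbit_poly i pg).
  have ei : 0 < eta ^+ (m - i) / m%:R.
    by rewrite divr_gt0 ?exprn_gt0// ltr0n (leq_ltn_trans _ (ltn_ord i)).
  have F0 : F (coord c x0) = 0.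
    have ax : a c x0 xi0 by rewrite ax0; exists 1%:M => //; rewrite mulmx1.
    by rewrite (Fa x0 xi0 x0c ax); exact: coef0.
  have Fc : {for x0, continuous (F \o coord c)}.
    apply: continuous_comp; first exact: coord_cont.
    apply: differentiable_continuous; apply/derivable1_diffP/Fhol.
    by exists x0.
  have /cvgrPdist_lt/(_ _ ei) := Fc.
  rewrite /= F0; apply: filterS => x Fx xc xi axi.
  by rewrite -(Fa x xi xc axi) -normrN -[- _]add0r.
have : \forall x \near x0, forall i : 'I_m, dom c x ->
    forall xi, a c x xi -> `|(orbit_poly ws g xi)`_i| < eta ^+ (m - i) / m%:R.
  exact: filter_forall.
apply: filterS => x xsmall xc xi axi.
apply: (monic_root_lt (monic_prod_XsubC _ _ _) (size_orbit_poly _ _)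
  (root_orbit_poly _ _)) => // i im.
exact: (xsmall (Ordinal im) xc xi axi).
Qed.

(** The pairing with al, at the type at which it is a generator of the ring of
    polynomial functions. *)
Definition root_value (al : 'cV[C]_n) xi : C^o := pairing xi al.

Lemma root_value_is_linear al : linear (root_value al).
Proof.
by move=> k u v; rewrite /root_value /pairing mulmxDl -scalemxAl !mxE.
Qed.

HB.instance Definition _ al := GRing.isLinear.Build C 'rV[C]_n C^o _
  (root_value al) (root_value_is_linear al).

(** Apply [polyfun_near_orbit] to the product g of the <xi, al> - rho, for rho
    in the finite set of values of al on the fibre over x0. If <xi, al> were purely
    imaginary, its distance to each rho would be at least |Re rho|, so that
    |g xi| would be at least the product of these positive numbers. *)
Lemma Re_root_value_near c x0 (al : 'cV[C]_n) : log_chart_at D c x0 ->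
  (forall xi, a c x0 xi -> complex.Re (pairing xi al) != 0) ->
  \forall x \near x0, dom c x -> forall xi, a c x xi ->
    complex.Re (pairing xi al) != 0.
Proof.
move=> cx0 Re0; have [cl x0c] := cx0; have [orb _ _] := ha cl.
have [xi0 ax0] := orb x0 x0c.
pose rho w := pairing (xi0 *m w) al.
have rho_re w : W w -> complex.Re (rho w) != 0.
  by move=> Ww; apply: Re0; rewrite ax0; exists w.
pose g xi : C := \prod_(w <- ws) (pairing xi al - rho w).
have pg : polyfun g.
  rewrite /g; elim: (ws) => [|w s IH].
    by under eq_fun do rewrite big_nil; exact: PolyConst.
  under eq_fun do rewrite big_cons.
  apply: PolyMul IH; apply: PolyAdd; last exact: PolyConst.
  exact: (PolyLin (root_value al)).
pose eta : C := \prod_(w <- ws) (`|complex.Re (rho w)|%:C)%C.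
have eta0 : 0 < eta.
  rewrite /eta big_seq; apply: prodr_gt0 => w wws.
  by rewrite -[0]/((0 : R)%:C)%C ltcR normr_gt0 rho_re// wsE.
have g0 xi : a c x0 xi -> g xi = 0.
  rewrite ax0 => -[w]; rewrite wsE /= => wws <-.
  apply/eqP; rewrite prodf_seq_eq0; apply/hasP; exists w => //=.
  by rewrite subrr.
have := polyfun_near_orbit cx0 pg g0 eta0.
apply: filterS => x gsmall xc xi axi; apply/negP => /eqP Re_xi.
have := gsmall xc xi axi; rewrite real_ltNge ?normr_real ?gtr0_real//.
move=> /negP; apply; rewrite /g normr_prod.
apply: ler_prod => w _; rewrite -[0]/((0 : R)%:C)%C lecR normr_ge0 /=.
have -> : complex.Re (rho w) = - complex.Re (pairing xi al - rho w).
  case: (pairing xi al) Re_xi => x1 y1 /= ->; case: (rho w) => x2 y2 /=.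
  by rewrite sub0r opprK.
by rewrite normrN normC_ge_Re.
Qed.

Lemma Re_roots_near (Phi : set 'cV[C]_n) c x0 : finite_set Phi ->
  log_chart_at D c x0 ->
  (forall xi al, a c x0 xi -> Phi al -> complex.Re (pairing xi al) != 0) ->
  \forall x \near x0, dom c x -> forall xi al, a c x xi -> Phi al ->
    complex.Re (pairing xi al) != 0.
Proof.
move=> /finite_seqP[als ->] cx0 Re0.
have near_al (al : seq_sub als) : \forall x \near x0, dom c x ->
    forall xi, a c x xi -> complex.Re (pairing xi (ssval al)) != 0.
  by apply: Re_root_value_near => // xi axi; apply: Re0 => //=; exact: ssvalP.
have : \forall x \near x0, forall al : seq_sub als, dom c x ->
    forall xi, a c x xi -> complex.Re (pairing xi (ssval al)) != 0.
  exact: filter_forall.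
apply: filterS => x xal xc xi al axi alals.
exact: (xal (SeqSub alals) xc xi axi).
Qed.

End Invariants.

(** * Exit times *)

Section FirstExit.
Variable R : realType.

Lemma first_exit (E : set R) (s u : R) : s <= u ->
  (forall t, s <= t <= u -> E t -> \forall t' \near t, E t') ->
  E s -> ~ E u ->
  exists t1, [/\ s < t1, t1 <= u, ~ E t1 & forall t, s <= t -> t < t1 -> E t].
Proof.
move=> su openE Es nEu; pose A := [set t | s <= t /\ ~ E t].
have Au : A u by [].
have lbA : lbound A s by move=> t [].
have hA : has_inf A by split; [exists u|exists s].
have Ainf t : A t -> inf A <= t by apply: ge_inf; exists s.
have infu : inf A <= u by exact: Ainf.
have sinf : s <= inf A by apply: lb_le_inf => //; exists u.
have nE : ~ E (inf A).
  move=> Einf; have := openE (inf A); rewrite sinf infu => /(_ isT Einf).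
  move=> /nbhs_ballP[e /= e0 be].
  have [t [st nEt] te] := inf_adherent e0 hA.
  have At : inf A <= t by apply: Ainf; split.
  apply: nEt; apply: be; rewrite /ball /= ltr_distlC te andbT.
  by rewrite (lt_le_trans _ At)// gtrBl.
exists (inf A); split => //.
  by rewrite lt_neqAle sinf andbT; apply/eqP => sE; apply: nE; rewrite -sE.
move=> t st tinf; apply: contrapT => nEt; move: tinf.
by rewrite ltNge => /negP; apply; apply: Ainf; split.
Qed.

(** Reverse time in [first_exit]. *)
Lemma last_exit (E : set R) (s u : R) : s <= u ->
  (forall t, s <= t <= u -> E t -> \forall t' \near t, E t') ->
  ~ E s -> E u ->
  exists t0, [/\ s <= t0, t0 < u, ~ E t0 & forall t, t0 < t -> t <= u -> E t].
Proof.
move=> su openE nEs Eu.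
have [||||t1 [ut1 t1s nEt1 Et]] := @first_exit (E \o -%R) (- u) (- s).
- by rewrite lerN2.
- move=> t /andP[ut ts] Et.
  have st : s <= - t <= u by rewrite lerNr ts lerNl ut.
  have := openE (- t) st Et.
  exact: opp_continuous.
- by rewrite /= opprK.
- by rewrite /= opprK.
exists (- t1); split.
- by rewrite lerNr.
- by rewrite ltrNl.
- exact: nEt1.
- by move=> t t1t tu; have := Et (- t); rewrite lerN2 ltrNl /= opprK; apply.
Qed.

Lemma small_step (e f : R) : 0 < e -> 0 < f ->
  exists h, [/\ 0 < h, h < e & h < f].
Proof.
move=> e0 f0; have m0 : 0 < Num.min e f by rewrite lt_min e0.
have : Num.min e f / 2 < Num.min e f by lra.
by rewrite lt_min => /andP[he hf]; exists (Num.min e f / 2); split => //; lra.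
Qed.

End FirstExit.

(** * Logarithmic charts and coordinate discs *)

Lemma nbhs_preimage (T U : topologicalType) (f : T -> U) (x : T) (V : set U) :
  {for x, continuous f} -> nbhs (f x) V -> nbhs x (f @^-1` V).
Proof. by move=> fx /fx. Qed.

Section Translation.
Variable F : numFieldType.

Lemma continuous_addr (w : F) : continuous (fun z : F => z + w).
Proof.
move=> z; apply: (@cvgD F F F (nbhs z) _ (fun z => z) (fun=> w)).
  exact: cvg_id.
exact: cvg_cst.
Qed.

Lemma derivable_shift (f : F -> F) (z z0 : F) : derivable f (z + z0) 1 ->
  derivable (fun w => f (w + z0)) z 1.
Proof.
rewrite /derivable; set q := (fun h => _); set q' := (fun h => _).
by have -> : q' = q by apply/funext => h; rewrite /q /q' /= addrA.
Qed.

End Translation.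

Lemma nbhs_ball_inside (K : numClosedFieldType) (z w e : K) :
  ball z e w -> nbhs w (ball z e).
Proof.
move=> zew; apply: open_nbhs_nbhs; split => //; exact: ball_open.
Qed.

Section Charts.
Variables (R : realType) (X : riemann_surface R).
Local Notation C := (CC R).

(** On its domain a chart is a homeomorphism. *)
Lemma open_coord_image (c : chart R X) (U : set X) : is_chart c -> open U ->
  U `<=` dom c -> open (coord c @` U).
Proof.
move=> [_ openim cK ccont icont] openU Uc; rewrite openE => _ [x Ux <-].
have xc := Uc _ Ux.
have zim : (coord c @` dom c) (coord c x) by exists x.
have near_im : \forall z \near coord c x, (coord c @` dom c) z.
  exact: open_nbhs_nbhs.
have near_U : \forall z \near coord c x, U (icoord c z).
  apply: (icont _ zim); rewrite cK//; exact: open_nbhs_nbhs.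
by apply: filterS2 near_im near_U => _ [y yc <-]; rewrite cK.
Qed.

Definition recentre (c : chart R X) (U : set X) (x : X) : chart R X :=
  Chart (dom c `&` U) (fun y => coord c y - coord c x)
    (fun z => icoord c (z + coord c x)).

Lemma local_coordinate_recentre c (U : set X) x : atlas c -> open U ->
  local_coordinate (recentre c U x).
Proof.
move=> cA openU; have cc := atlas_chart cA; have [openc _ cK ccont icont] := cc.
have openI : open (dom c `&` U) by exact: openI.
split.
  split => //=.
  - have -> : [set coord c y - coord c x | y in dom c `&` U] =
              (fun z => z + coord c x) @^-1` (coord c @` (dom c `&` U)).
      apply/seteqP; split=> [_ [y yU <-]|z [y yU yz]] /=.
        by exists y => //; rewrite subrK.
      by exists y => //; rewrite yz addrK.
    apply: open_comp; first by move=> z _; exact: continuous_addr.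
    by apply: open_coord_image => // y [].
  - by move=> y [yc _]; rewrite subrK cK.
  - move=> y [yc _]; apply: cvgD; [exact: ccont|exact: cvg_cst].
  - move=> _ [y [yc _] <-].
    apply: (@continuous_comp _ _ _ (fun z : C => z + coord c x)).
      exact: continuous_addr.
    by apply: icont; rewrite subrK; exists y.
move=> c' c'A; have [hol hol'] := atlas_compatible cA c'A; split.
  move=> _ [y [[yc _] yc'] <-] /=.
  apply: (@derivable_shift C (coord c' \o icoord c) _ (coord c x)).
  by apply: hol; rewrite subrK; exists y.
move=> _ [y [[yc _] yc'] <-] /=.
apply: (@derivableB _ _ _ (coord c \o icoord c')); last exact: derivable_cst.
by apply: hol'; exists y.
Qed.

(** Translate a chart of the atlas so that it vanishes at x, and remove from its
    domain the points of D other than x, which form a closed set. *)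
Lemma log_chart_centred (D : {fset X}) (x : X) :
  exists2 c, log_chart_at D c x & coord c x = 0.
Proof.
have [c cA xc] := atlas_cover x.
pose U : set X := ~` [set y | y \in D /\ y <> x].
have openU : open U.
  have closed_finite := (@accessible_finite_set_closed X).1
    (hausdorff_accessible (@space_hausdorff _ X)).
  apply: closed_openC; apply: closed_finite.
  apply: (@sub_finite_set _ _ [set` D]); first by move=> y [].
  exact: finite_fset.
exists (recentre c U x); rewrite /= ?subrr//; split=> /=; last first.
  by split=> // -[].
split; first exact: local_coordinate_recentre.
move=> y yD /= [_ Uy]; suff -> : y = x by rewrite subrr.
by apply: contrapT => yx; apply: Uy.
Qed.

Definition coord_disc (c : chart R X) (r : R) : set X :=
  dom c `&` coord c @^-1` ball (0 : C) (r%:C)%C.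

Lemma coord_discE c r x : 0 < r ->
  coord_disc c r x <-> dom c x /\ normsq (coord c x) < r ^+ 2.
Proof.
by move=> r0; rewrite -normsq_lt// /coord_disc /ball /= sub0r normrN.
Qed.

(** The inverse of the coordinate maps small discs around 0 into U. *)
Lemma coord_disc_sub c x (U : set X) : is_chart c -> dom c x ->
  coord c x = 0 -> nbhs x U ->
  exists r : R, [/\ 0 < r, ball (0 : C) (r%:C)%C `<=` coord c @` dom c &
    coord_disc c r `<=` U].
Proof.
move=> [openc openim cK ccont icont] xc cx0 xU.
have zim : (coord c @` dom c) 0 by exists x.
have near_im : \forall z \near (0 : C), (coord c @` dom c) z.
  exact: open_nbhs_nbhs.
have near_U : \forall z \near (0 : C), U (icoord c z).
  by apply: (icont _ zim); rewrite -cx0 cK.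
have [e /= e0 be] := (nbhs_ballP _ _).1 (filterI near_im near_U).
have eE : ((complex.Re e)%:C)%C = e by apply: RRe_real; exact: gtr0_real.
exists (complex.Re e); split; last 2 first.
- by rewrite eE => z /be[].
- by rewrite /coord_disc eE => y [yc /be[_]]; rewrite cK.
- by rewrite -ltcR eE.
Qed.

Lemma open_coord_disc c r : is_chart c -> open (coord_disc c r).
Proof.
move=> [openc _ _ ccont _]; rewrite openE => x [xc xr].
apply: filterI; first exact: open_nbhs_nbhs.
exact: (nbhs_preimage (ccont x xc) (nbhs_ball_inside xr)).
Qed.

End Charts.

(** * Stokes curves in a disc around a point of D *)

Lemma continuous_pairing (R : realType) (n : nat) (al : 'cV[CC R]_n) :
  continuous (fun xi : 'rV[CC R]_n => pairing xi al).
Proof.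
move=> xi; rewrite /pairing.
have -> : (fun xi0 : 'rV[CC R]_n => (xi0 *m al) 0 0) =
          (fun xi0 => \sum_j xi0 0 j * al j 0).
  by apply/funext => xi0; rewrite mxE.
have cj j : {for xi, continuous (fun xi0 : 'rV[CC R]_n => xi0 0 j * al j 0)}.
  apply: (@cvgM _ _ (nbhs xi) _ (fun xi0 : 'rV[CC R]_n => xi0 0 j)
    (fun=> al j 0)).
    exact: coord_continuous.
  exact: cvg_cst.
apply: (@cvg_big _ _ _ _ _ _ _ (nbhs xi) _ (fun j xi0 => xi0 0 j * al j 0)).
  exact: add_continuous.
by move=> j _; exact: cj.
Qed.

Section CurvesInDisc.
Variables (R : realType) (X : riemann_surface R) (D : {fset X}) (n : nat).
Local Notation C := (CC R).
Variables (Phi : set 'cV[C]_n) (a : local_sections X n).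
Variables (c : chart R X) (d : X) (r : R).
Hypothesis c_log : log_chart D c.
Hypothesis dD : d \in D.
Hypothesis d_c : dom c d.
Hypothesis r0 : 0 < r.
Local Notation B := (coord_disc c r).
(* The coordinate is thus defined on the boundary of B, where |z| = r. *)
Hypothesis clB : closure B `<=` dom c.
Hypothesis ReB : forall x xi al, B x -> a c x xi -> Phi al ->
  complex.Re (pairing xi al) != 0.

(** By [derive_normsq], its sign tells whether a curve labelled al and passing
    through p moves away from d or towards it. *)
Definition slope (al : 'cV[C]_n) (p : tK_point X n) : R :=
  complex.Re (pairing (p.2 c) al).

Section OneCurve.
Variable l : curve X n.
Hypothesis l_int : integral_curve D a l.
Hypothesis l_start : cameral_cover_X D a (traj l 0).
Hypothesis l_root : Phi (label l).

Local Notation x t := (traj l t).1 (only parsing).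
Local Notation A t := (slope (label l) (traj l t)) (only parsing).
Local Notation Nsq := (fun t : R => normsq (coord c (traj l t).1)).
Local Notation N t := (normsq (coord c (traj l t).1)) (only parsing).

Lemma life_le s t : life l s -> 0 <= t -> t <= s -> life l t.
Proof.
move=> [_ sdur] t0 ts; split => //; apply: le_lt_trans sdur.
by rewrite lee_fin.
Qed.

Lemma traj_cameral s : life l s -> cameral_cover_X D a (traj l s).
Proof.
move=> ls; have [s0 _] := ls; case: (ltgtP 0 s) s0 => // [s0 _|<- _] //.
by have [_ _ _ /(_ s ls s0)[]] := l_int.
Qed.

Lemma continuous_base s : life l s -> {for s, continuous (fun t => x t)}.
Proof.
move=> ls; have [_ /(_ s ls) contl _ _] := l_int.
have [c' c's _] := log_chart_centred D (traj l s).1.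
move=> U Us; have /contl : nbhs_tK D (traj l s) (fst @^-1` U).
  exists c'; split => //.
  by exists U, setT; split => //; exact: filterT.
by [].
Qed.

Lemma continuous_slope s : life l s -> dom c (x s) ->
  {for s, continuous (fun t => A t)}.
Proof.
move=> ls sc; have [_ /(_ s ls) contl _ _] := l_int.
have xi_cont : {for s, continuous (fun t => (traj l t).2 c)}.
  move=> V Vs; have /contl : nbhs_tK D (traj l s) (fun q => V (q.2 c)).
    exists c; split => //.
    by exists setT, V; split => //; exact: filterT.
  by [].
apply: (@continuous_comp _ _ _ (fun t => pairing ((traj l t).2 c) (label l))).
  apply: (@continuous_comp _ _ _ (fun t => (traj l t).2 c)
    (fun xi => pairing xi (label l))) => //.
  exact: continuous_pairing.
exact: continuous_Re.
Qed.

Lemma continuous_normsq s : life l s -> dom c (x s) -> {for s, continuous Nsq}.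
Proof.
move=> ls sc; have [[[_ _ _ ccont _] _] _] := c_log.
have zc : {for s, continuous (fun t => coord c (x t))}.
  by apply: continuous_comp; [exact: continuous_base|exact: ccont].
apply: cvgD; rewrite /= expr2; apply: cvgM.
all: apply: (@continuous_comp _ _ _ (fun t => coord c (x t))) => //.
all: by [exact: continuous_Re|exact: continuous_Im].
Qed.

Lemma slope_neq0 s : life l s -> B (x s) -> A s != 0.
Proof.
move=> ls Bs; have [[_ acov] _] := traj_cameral ls.
by apply: ReB (Bs) _ _ => //; apply: acov; split => //; case: Bs.
Qed.

Lemma B_near s : life l s -> B (x s) -> \forall t \near s, B (x t).
Proof.
move=> ls Bs; have openB : open B by apply: open_coord_disc; have [[]] := c_log.
exact: (nbhs_preimage (continuous_base ls) (open_nbhs_nbhs (conj openB Bs))).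
Qed.

(** A change of sign would produce a zero of the slope by the intermediate value
    theorem. *)
Lemma slope_sign t1 t2 : 0 <= t1 -> t1 <= t2 -> life l t2 ->
  (forall t, t1 <= t -> t <= t2 -> B (x t)) -> (A t1 < 0) = (A t2 < 0).
Proof.
move=> t10 t12 lt2 Bt.
have lt t : t1 <= t -> t <= t2 -> life l t.
  by move=> t1t; apply: life_le => //; exact: le_trans t1t.
have Acont : {within `[t1, t2], continuous (fun t => A t)}.
  apply: continuous_in_subspaceT => t; rewrite inE/= in_itv/= => /andP[t1t tt2].
  by apply: continuous_slope; [exact: lt|case: (Bt t t1t tt2)].
have A1 : A t1 != 0 by apply: slope_neq0; [exact: lt|exact: Bt].
have A2 : A t2 != 0 by apply: slope_neq0; [exact: lt|exact: Bt].
have noroot : ~~ (Num.min (A t1) (A t2) <= 0 <= Num.max (A t1) (A t2)).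
  apply/negP => /(IVT t12 Acont)[t]; rewrite in_itv/= => /andP[t1t tt2] At0.
  by have := slope_neq0 (lt t t1t tt2) (Bt t t1t tt2); rewrite /= At0 eqxx.
move: noroot; rewrite ge_min le_max.
by case: (ltgtP (A t1) 0) A1; case: (ltgtP (A t2) 0) A2.
Qed.

(** Writing z = zu + i zv for the coordinate, p for <xi, al> and w = u + i v for
    dz/dt, the equation of the curve is p w = z, so that
    zu u + zv v = Re (conj w * p w) = |w|^2 Re p. *)
Lemma derive_normsq s : life l s -> 0 < s -> dom c (x s) ->
  exists2 k : R, 0 <= k & is_derive s 1 Nsq (2 * k * A s).
Proof.
move=> ls s0 sc; have [_ _ _ /(_ s ls s0)[_ _ /(_ c (conj c_log sc))]] := l_int.
move=> [u [v [du dv]]]; rewrite /chi /frame.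
case: asboolP => [_|]; last by case; exists d.
rewrite -/(pairing _ _) /slope.
case zE : (coord c (x s)) => [zu zv].
case pE : (pairing ((traj l s).2 c) (label l)) => [pu pv] chi1.
have z0 : (zu +i* zv)%C != 0 :> C.
  by apply: contra_eq_neq chi1 => ->; rewrite invr0 mulr0 mul0r eq_sym oner_eq0.
have : (pu +i* pv)%C * (u +i* v)%C = (zu +i* zv)%C :> C.
  by rewrite -[RHS]mul1r -chi1 mulrAC divfK.
move=> [zuE zvE]; exists (u ^+ 2 + v ^+ 2); first by rewrite addr_ge0 ?sqr_ge0.
have dN := is_deriveD (is_deriveX 2 du) (is_deriveX 2 dv).
rewrite exprfctE exprfctE addrfctE in dN.
apply: (is_derive_eq dN) => /=; rewrite zE /= -zuE -zvE.
rewrite !expr1 /GRing.scale /=; ring.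
Qed.

Lemma traj_closure t0 : life l t0 ->
  (forall e : R, 0 < e -> exists2 t, `|t0 - t| < e & B (x t)) ->
  closure B (x t0).
Proof.
move=> lt0 close U Ut0.
have /nbhs_ballP[e /= e0 be] : \forall t \near t0, U (x t).
  exact: (nbhs_preimage (continuous_base lt0) Ut0).
by have [t t0t Bt] := close e e0; exists (x t); split => //; exact: be.
Qed.

Lemma normsq_monotone t1 t2 : 0 <= t1 -> t1 <= t2 -> life l t2 ->
  dom c (x t1) -> dom c (x t2) -> (forall t, t1 < t < t2 -> B (x t)) ->
  ((forall t, t1 < t < t2 -> A t <= 0) -> N t2 <= N t1) /\
  ((forall t, t1 < t < t2 -> 0 <= A t) -> N t1 <= N t2).
Proof.
move=> t10 t12 lt2 c1 c2 Bt.
have lt t : t1 <= t -> t <= t2 -> life l t.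
  by move=> t1t; apply: life_le => //; exact: le_trans t1t.
have Ncont : {within `[t1, t2], continuous Nsq}.
  apply: continuous_in_subspaceT => t; rewrite inE/= in_itv/= => /andP[t1t tt2].
  apply: continuous_normsq; first exact: lt.
  move: t1t tt2; rewrite le_eqVlt => /orP[/eqP<- _|t1t] //.
  rewrite le_eqVlt => /orP[/eqP->|tt2] //.
  by have [] : B (x t) by apply: Bt; rewrite t1t.
have dN t : t \in `]t1, t2[ ->
    exists2 k : R, 0 <= k & is_derive t 1 Nsq (2 * k * A t).
  rewrite in_itv/= => /andP[t1t tt2]; apply: derive_normsq.
  - by apply: lt; exact: ltW.
  - exact: le_lt_trans t1t.
  - by have [] : B (x t) by apply: Bt; rewrite t1t.
have dNable t : t \in `]t1, t2[ -> derivable Nsq t 1.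
  by move=> /dN[k _ dNt]; exact: ex_derive.
split=> At.
  apply: (ler0_derive1_nincr dNable _ Ncont) => // t tin.
  have [k k0 dNt] := dN t tin; rewrite derive1E derive_val.
  by rewrite mulr_ge0_le0 ?mulr_ge0//; apply: At; rewrite in_itv in tin.
apply: (ger0_derive1_ndecr dNable _ Ncont) => // t tin.
have [k k0 dNt] := dN t tin; rewrite derive1E derive_val.
by rewrite !mulr_ge0//; apply: At; rewrite in_itv in tin.
Qed.

(** Let t0 be the last time before s at which the curve is outside B. It lies on
    the boundary of B at that time; if the slope were positive, |z| would be
    non-decreasing on [t0, s], so that it would be < r at t0, too. *)
Lemma slope_lt0_entering s0 s : life l s0 -> life l s -> s0 < s ->
  ~ B (x s0) -> B (x s) -> A s < 0.
Proof.
move=> [s00 _] ls s0s nBs0 Bs.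
have [|t0 [s0t0 t0s nBt0 Bt]] :=
  @last_exit R (fun t => B (x t)) s0 s (ltW s0s) _ nBs0 Bs.
  move=> t /andP[s0t ts]; apply: B_near; apply: (life_le ls) => //.
  exact: le_trans s0t.
have t00 : 0 <= t0 by exact: le_trans s0t0.
have lt0 : life l t0 by apply: (life_le ls) => //; exact: ltW.
have t0c : dom c (x t0).
  apply: clB; apply: traj_closure => // e e0.
  have st0 : 0 < s - t0 by rewrite subr_gt0.
  have [h [h0 he hs]] := small_step e0 st0.
  exists (t0 + h); first by rewrite opprD addNKr normrN gtr0_norm.
  by apply: Bt; lra.
have [sc sr] := (coord_discE _ _ r0).1 Bs.
case: ltP => // As; exfalso; apply: nBt0; apply/coord_discE => //; split => //.
apply: le_lt_trans sr.
have [] := normsq_monotone t00 (ltW t0s) ls t0c sc.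
  by move=> t /andP[t0t ts]; apply: Bt => //; exact: ltW.
move=> _; apply=> t /andP[t0t ts]; rewrite leNgt.
rewrite (@slope_sign t s) ?(ltW ts) -?leNgt//.
  by rewrite (le_trans t00)// ltW.
by move=> t' tt' t's; apply: Bt => //; exact: lt_le_trans tt'.
Qed.

(** At the first time after s outside B, the curve would be on the boundary of
    B, where |z| = r, although |z| has not increased since s. *)
Lemma stays_of_slope_lt0 s u : life l s -> B (x s) -> A s < 0 ->
  life l u -> s <= u -> B (x u).
Proof.
move=> [s0 sdur] Bs As lu su; apply: contrapT => nBu.
have [|t1 [st1 t1u nBt1 Bt]] :=
  @first_exit R (fun t => B (x t)) s u su _ Bs nBu.
  move=> t /andP[st tu]; apply: B_near; apply: (life_le lu) => //.
  exact: le_trans st.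
have t10 : 0 <= t1 by exact: le_trans (ltW st1).
have lt1 : life l t1 by exact: (life_le lu).
have t1c : dom c (x t1).
  apply: clB; apply: traj_closure => // e e0.
  have st10 : 0 < t1 - s by rewrite subr_gt0.
  have [h [h0 he hs]] := small_step e0 st10.
  exists (t1 - h); first by rewrite opprB addrC subrK gtr0_norm.
  by apply: Bt; lra.
have [sc sr] := (coord_discE _ _ r0).1 Bs.
apply: nBt1; apply/coord_discE => //; split => //; apply: le_lt_trans sr.
have [] := normsq_monotone s0 (ltW st1) lt1 sc t1c.
  by move=> t /andP[st tt1]; apply: Bt => //; exact: ltW.
move=> + _; apply=> t /andP[st tt1]; apply: ltW.
rewrite -(@slope_sign s t) ?(ltW st)//.
  by apply: (life_le lt1); [exact: le_trans (ltW st)|exact: ltW].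
by move=> t' st' t't; apply: Bt => //; exact: le_lt_trans tt1.
Qed.

Lemma slope_lt0_from_start s : (B (x 0) -> A 0 < 0) ->
  life l s -> B (x s) -> A s < 0.
Proof.
move=> start ls Bs; have [s0 _] := ls.
have [[s1 [s10 s1s nBs1]]|allB] :=
    pselect (exists s1, [/\ 0 <= s1, s1 < s & ~ B (x s1)]).
  by apply: (@slope_lt0_entering s1 s) => //; exact: (life_le ls _ (ltW s1s)).
have Bt t : 0 <= t -> t <= s -> B (x t).
  rewrite [t <= s]le_eqVlt => t0 /orP[/eqP->//|ts].
  by apply: contrapT => nBt; apply: allB; exists t.
by rewrite -(@slope_sign 0 s)//; apply/start/Bt.
Qed.

End OneCurve.

Lemma stage_curve k l : stage D Phi a k l ->
  [/\ integral_curve D a l, cameral_cover_X D a (traj l 0) & Phi (label l)].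
Proof.
elim: k l => [|k IH] l /=.
  by move=> [[lint _] [Phil [[covl _] _]]].
by move=> [/IH//|[[lint _] [[covl _ _] [Phil _]]]].
Qed.

Hypothesis Phi0 : ~ Phi 0.

Lemma slope_sum_lt0 (als : seq 'cV[C]_n) p : als != [::] ->
  (forall al, al \in als -> slope al p < 0) ->
  slope (\sum_(al <- als) al) p < 0.
Proof.
have slopeD al be : slope (al + be) p = slope al p + slope be p.
  rewrite /slope /pairing mulmxDr mxE.
  by case: (fun_of_matrix _ _ _) => ? ?; case: (fun_of_matrix _ _ _).
case: als => // al als _; elim: als al => [|be als IH] al als0.
  by rewrite big_seq1; apply: als0; rewrite mem_head.
rewrite big_cons slopeD -[ltRHS]addr0; apply: ltrD.
  by apply: als0; rewrite mem_head.
by apply: IH => ga ga_in; apply: als0; rewrite inE ga_in orbT.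
Qed.

(** By [slope_lt0_from_start] only the curves starting in B matter. There are no
    such primary curves, and the label of a new curve is a sum of labels of
    curves arriving at its starting point, to which the induction hypothesis
    applies. *)
Lemma stage_slope_lt0 k l s : stage D Phi a k l -> life l s ->
  B (traj l s).1 -> slope (label l) (traj l s) < 0.
Proof.
elim: k l s => [|k IH] l s Sl ls Bs; have [lint lcov Phil] := stage_curve Sl;
  apply: slope_lt0_from_start => // B0.
  (* A primary curve starts on the hyperplane of its label. *)
  have [_ [_ [_ /(_ c) on_hyp]]] := Sl.
  have : slope (label l) (traj l 0) != 0.
    apply: ReB (B0) _ _ => //; have [[_ acov] _] := lcov.
    by apply: acov; split => //; case: B0.
  by rewrite /slope on_hyp ?eqxx//; split => //; case: B0.
case: Sl => [Sl|[_ [_ [_ [_ [als inc lE]]]]]].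
  by apply: IH => //; split=> //; have [] := lint.
(* The sum is not empty, since 0 is not a root. *)
rewrite lE; apply: slope_sum_lt0 => [|al /inc[l' [s' [Sl' <- ls' _ l's']]]].
  by apply: contra_notN Phi0 => /eqP als0; move: Phil; rewrite lE als0 big_nil.
by rewrite -l's'; apply: IH => //; rewrite l's'.
Qed.

End CurvesInDisc.

Theorem proposition1p3 (R : realType) (N : nat) (G T : set 'M[CC R]_N)
    (n : nat) (iota : {linear 'rV[CC R]_n -> 'M[CC R]_N})
    (X : riemann_surface R) (D : {fset X}) (a : local_sections X n)
    (hG : reductive G) (hT : maximal_torus G T)
    (hiota : coordinates_on_Lie iota T)
    (hcompact : compact [set: X]) (hconnected : connected [set: X])
    (hD : (2 < #|` D|)%N)
    (ha : hitchin_base_diamond D (roots_of G iota) (weyl G T iota) a)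
    (hR : condition_R D (roots_of G iota) a) :
  forall d : X, d \in D ->
  exists B : set X, [/\ open_disc B, B d &
    forall l : curve X n, stokes_curve D (roots_of G iota) a l ->
      (forall s : R, enters_at l B s -> stays_from l B s) /\
      (new_stokes_curve D (roots_of G iota) a l -> lies_over B (traj l 0) ->
         stays_from l B 0)].
Proof.
move=> d dD; have [hGalg _ _] := hG; have [hTtorus _ _] := hT.
have [hbase _] := ha.
have [c cd cd0] := log_chart_centred D d; have [c_log d_c] := cd.
have c_chart : is_chart c by have [[]] := c_log.
have [ws wsE] := (finite_seqP _).1 (weyl_finite hGalg hTtorus hiota).
have wsE' : weyl G T iota = [set` undup ws].
  by rewrite wsE; apply/seteqP; split=> w /=; rewrite mem_undup.
have nearRe := Re_roots_near (weyl1 T iota hGalg)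
  (fun w w' => weylM hGalg (w := w) (w' := w'))
  (fun w => weyl_unit hGalg hiota (w := w)) (undup_uniq ws) wsE' hbase
  (roots_finite G hTtorus hiota) cd (fun xi al => hR d c xi al dD cd).
have near_c : nbhs d (dom c).
  by apply: open_nbhs_nbhs; split => //; have [] := c_chart.
(* A compact Hausdorff space is regular, which yields a neighbourhood of d
   whose closure is contained in the domain of the chart. *)
have [V dV clV] : exists2 V : set X, nbhs d V & closure V `<=` dom c.
  have regular := compact_regular (@space_hausdorff _ X) hcompact
    (filterT : nbhs d setT).
  exact: regular near_c.
have [r [r0 rim discV]] := coord_disc_sub c_chart d_c cd0 (filterI dV nearRe).
have clB : closure (coord_disc c r) `<=` dom c.
  by apply: subset_trans clV; apply: closure_subset => y /discV[].
have ReB y xi al : coord_disc c r y -> a c y xi -> roots_of G iota al ->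
    complex.Re (pairing xi al) != 0.
  by move=> By; have [_] := discV y By; apply; case: By.
have Phi0 : ~ roots_of G iota 0 by case; rewrite eqxx.
exists (coord_disc c r); split.
- exists c; split; first by case: c_log.
  by exists 0, (r%:C)%C; split => //; rewrite -[0]/((0 : R)%:C)%C ltcR.
- apply/coord_discE => //; split => //.
  by rewrite cd0 /normsq /= expr0n addr0 exprn_gt0.
move=> l [_ [k Sl]]; have [lint lcov Phil] := stage_curve Sl.
have stays s : life l s -> coord_disc c r (traj l s).1 ->
    stays_from l (coord_disc c r) s.
  move=> ls Bs u lu su.
  have slope0 := stage_slope_lt0 c_log dD d_c r0 clB ReB Phi0 Sl ls Bs.
  exact: (stays_of_slope_lt0 c_log dD d_c r0 clB ReB lint lcov Phil ls Bs
    slope0 lu su).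
split=> [s [ls Bs _]|_ B0]; first exact: stays.
by apply: stays => //; split => //; have [] := lint.
Qed.
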